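(* Let $I=(x_1,\ldots,x_n)$ be any list of items with sizes $x_i\in(1/3,1]$. Then $$\mathbb{E}[\mathrm{BF}(I^\sigma)] \le \frac{5}{4}\,\mathrm{OPT}(I)+\frac14,$$ where $\sigma$ is drawn uniformly at random from the set $\mathcal{S}_n$ of permutations of $[n]$ and the expectation is over $\sigma$.
   Context: Bin packing: given a list $I=(x_1,\ldots,x_n)$ of items with sizes in $(0,1]$, a packing assigns items to unit-capacity bins so that the total size of items in each bin is at most $1$. $\mathrm{OPT}(I)$ denotes the minimum number of bins in a feasible packing. The online algorithm Best Fit (BF) processes the items in the given order and packs the current item into the fullest bin (largest current load) into which it fits, opening a new bin if it fits into no existing bin; items are never moved. $\mathrm{BF}(I)$ denotes the number of bins Best Fit uses on list $I$. For a permutation $\sigma\in\mathcal{S}_n$, $I^\sigma=(x_{\sigma(1)},\ldots,x_{\sigma(n)})$. *)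

(* Defs.v *)
From HB Require Import structures.
From mathcomp Require Import all_boot all_order all_algebra all_fingroup.
From mathcomp Require Import all_reals.
Set Implicit Arguments. Unset Strict Implicit. Unset Printing Implicit Defensive.
Import Order.TTheory GRing.Theory Num.Theory.
Local Open Scope ring_scope.

Section BinPacking.
Variable R : realType.

Definition packable (n m : nat) (x : 'I_n -> R) : bool :=
  [exists f : {ffun 'I_n -> 'I_m},
     [forall b : 'I_m, \sum_(i < n | f i == b) x i <= 1]].

(* OPT(I): the minimum number of bins of a feasible packing.
   (For sizes in (0,1], m = n is always feasible, so the minimum is
   attained among m <= n; the default value n is never used then.) *)
Definition OPT (n : nat) (x : 'I_n -> R) : nat :=
  \big[minn/n]_(m < n.+1 | packable m x) m.

Definition bf_step (loads : seq R) (a : R) : seq R :=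
  let fits := [seq l <- loads | l + a <= 1] in
  match fits with
  | [::] => rcons loads a
  | l0 :: _ =>
      let best := foldr Num.max l0 fits in
      set_nth 0 loads (index best loads) (best + a)
  end.

Definition BF (I : seq R) : nat := size (foldl bf_step [::] I).

Definition permuted_list (n : nat) (x : 'I_n -> R) (s : 'S_n) : seq R :=
  [seq x (s i) | i <- enum 'I_n].

Definition expected_BF (n : nat) (x : 'I_n -> R) : R :=
  (\sum_(s : 'S_n) (BF (permuted_list x s))%:R) / (#|{perm 'I_n}|)%:R.

End BinPacking.

(* Main.v *)
(** Call an item large if its size exceeds 1/2 and small otherwise; a bin holds
    at most two items, at most one of them large.  Fix an optimal packing and
    call a bin holding a large and a small item mixed.  If the large item arrives
    first in [X] of the [N] mixed bins, an exchange argument shows that Best Fit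
    itself forms at least [X] large-small bins; as any two small items fit
    together, it leaves at most one small item alone, so
    [BF <= n - floor ((#small + X) / 2) <= OPT + ceil (Y / 2)] with [Y = N - X].
    Swapping the two items of a mixed bin in the arrival order changes only the
    contribution of that bin to [Y], so [Y] has mean [N / 2] and, if [N > 0], is
    odd with probability 1/2, whence [E[ceil (Y / 2)] <= (N + 1) / 4]. *)

Require Import Defs.
From HB Require Import structures.
From mathcomp Require Import all_boot all_order all_algebra all_fingroup.
From mathcomp Require Import all_reals.
From mathcomp Require Import zify lra.
Import Order.TTheory GRing.Theory Num.Theory.
Local Open Scope ring_scope.
Set Implicit Arguments. Unset Strict Implicit. Unset Printing Implicit Defensive.

(** * Matchings of small items to earlier large items *)

Section BestFit.
Variable R : realType.
Implicit Types (a l x : R) (S T r loads : seq R) (g : nat).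

(** Also applied to bin loads: a load above 1/2 is one large item or two items. With items above
    1/3, a two-item load admits nothing more, so its presence in a stock of large loads is
    harmless. *)
Definition large x : bool := 1 / 2 < x.

(* Some way of processing [r], starting with the large items [S] unmatched,
   matches exactly [g] non-large items of [r] to earlier large items. *)
Fixpoint lm_matching S r g : Prop :=
  match r with
  | [::] => g = 0%N
  | a :: r' =>
      if large a then lm_matching (a :: S) r' g
      else lm_matching S r' g \/
           exists l S' g', [/\ perm_eq S (l :: S'), l + a <= 1, g = g'.+1
                             & lm_matching S' r' g']
  end.

Lemma perm_consCA a l S : perm_eq [:: a, l & S] [:: l, a & S].
Proof. exact: permEl (perm_catCA [:: a] [:: l] S). Qed.

Lemma lm_matching0 S r : lm_matching S r 0.
Proof.
elim: r S => [//|a r IH] S /=; case: ifP => _; first exact: IH.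
by left; apply: IH.
Qed.

Lemma lm_matching_perm S T r g :
  perm_eq S T -> lm_matching S r g -> lm_matching T r g.
Proof.
elim: r S T g => [//|a r IH] S T g pST /=; case: ifP => _.
  by apply: IH; rewrite perm_cons.
case=> [w|[l [S' [g' [pS la gE w]]]]]; first by left; apply: IH w.
right; exists l, S', g'; split=> //.
by rewrite (perm_trans _ pS) // perm_sym.
Qed.

Lemma lm_matching_cons l S r g : lm_matching S r g -> lm_matching (l :: S) r g.
Proof.
elim: r S g => [//|a r IH] S g /=; case: ifP => _.
  by move=> /IH; apply: lm_matching_perm; apply: (perm_consCA l a S).
case=> [w|[l' [S' [g' [pS la gE w]]]]]; first by left; apply: IH.
right; exists l', (l :: S'), g'; split=> //; last exact: IH.
by rewrite perm_sym (perm_trans (perm_consCA l' l S')) //= perm_cons perm_sym.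
Qed.

Lemma perm_cons_split (x l : R) S S' : perm_eq (x :: S) (l :: S') ->
  (x = l /\ perm_eq S S') \/
  (exists U, perm_eq S (l :: U) /\ perm_eq S' (x :: U)).
Proof.
move=> p; have [xl|xl] := eqVneq x l.
  by left; split=> //; move: p; rewrite xl perm_cons.
right.
have xS' : x \in S'.
  by have := perm_mem p x; rewrite !inE eqxx /= (negbTE xl) /= => <-.
have pS' := perm_to_rem xS'.
exists (rem x S'); split=> //.
rewrite -(perm_cons x) (perm_trans p) //.
by apply: perm_trans (perm_consCA l x _); rewrite perm_cons.
Qed.

(** Whatever fits with [x] fits with the smaller [l], so [l] takes over the role of [x]. *)
Lemma lm_matching_le l x S r g :
  l <= x -> lm_matching (x :: S) r g -> lm_matching (l :: S) r g.
Proof.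
move=> lx; elim: r S g => [//|a r IH] S g /=; case: ifP => _.
  move=> w; apply: (@lm_matching_perm [:: l, a & S]).
    exact: (perm_consCA l a S).
  by apply: IH; apply: lm_matching_perm w; apply: (perm_consCA a x S).
case=> [w|[l' [S' [g' [pS la gE w]]]]]; first by left; apply: IH.
right; case: (perm_cons_split pS) => [[xl pSS]|[U [pSU pSx]]].
  exists l, S, g'; split=> //; first by lra.
  by apply: lm_matching_perm w; rewrite perm_sym.
exists l', (l :: U), g'; split=> //.
  by apply: perm_trans (perm_consCA l l' U); rewrite perm_cons.
by apply: IH; apply: lm_matching_perm w.
Qed.

(** At most one pair uses [x]; giving up that pair leaves the others intact. *)
Lemma lm_matching_behead x S r g :
  lm_matching (x :: S) r g -> lm_matching S r g.-1.
Proof.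
elim: r S g => [|a r IH] S g /=; first by move=> ->.
case: ifP => _.
  move=> w; apply: IH; apply: lm_matching_perm w.
  exact: (perm_consCA a x S).
case=> [w|[l' [S' [g' [pS la -> w]]]]]; first by left; apply: IH.
case: (perm_cons_split pS) => [[xl pSS]|[U [pSU pSx]]].
  by left; apply: lm_matching_perm w; rewrite perm_sym.
case: g' w => [|g'] w; first by left; apply: lm_matching0.
right; exists l', U, g'; split=> //.
by apply: (IH U g'.+1); apply: lm_matching_perm w.
Qed.

(** * One step of Best Fit and the exchange argument *)

Lemma foldr_max_ge l0 s l : l \in s -> l <= foldr Num.max l0 s.
Proof.
elim: s => //= y s IH; rewrite inE le_max => /predU1P[->|/IH ->].
  by rewrite lexx.
by rewrite orbT.
Qed.

Lemma foldr_max_mem l0 s : l0 \in s -> foldr Num.max l0 s \in s.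
Proof.
move=> l0s; have : foldr Num.max l0 s \in l0 :: s.
  elim: s {l0s} => [|y s IH] /=; first by rewrite mem_head.
  rewrite maxEle; case: ifP => _; last by rewrite !inE eqxx orbT.
  by move: IH; rewrite !inE => /orP[->//|->]; rewrite !orbT.
by rewrite inE => /predU1P[->|].
Qed.

(** Loads are described up to permutation, since only counts and the stock of large loads matter
    later: [x] is the chosen load and [T] the other ones. *)
Variant bf_step_spec loads a : seq R -> Prop :=
| BfOpen of (forall l, l \in loads -> 1 < l + a) :
    bf_step_spec loads a (rcons loads a)
| BfFit x T loads' of perm_eq loads (x :: T) & x + a <= 1
    & (forall l, l \in loads -> l + a <= 1 -> l <= x)
    & perm_eq loads' (x + a :: T) : bf_step_spec loads a loads'.

Lemma bf_stepP loads a : bf_step_spec loads a (bf_step loads a).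
Proof.
rewrite /bf_step; case E: [seq l <- loads | l + a <= 1] => [|l0 s].
  apply: BfOpen => l lin; rewrite ltNge; apply/negP => la.
  by have := mem_filter (fun l => l + a <= 1) l loads; rewrite E la lin.
set best := foldr _ _ _.
have : best \in [seq l <- loads | l + a <= 1].
  by rewrite E /best; apply: foldr_max_mem; rewrite mem_head.
rewrite mem_filter => /andP[ba bin].
have ib : (index best loads < size loads)%N by rewrite index_mem.
apply: (@BfFit loads a best
  (take (index best loads) loads ++ drop (index best loads).+1 loads)).
- rewrite -{1}(cat_take_drop (index best loads) loads) (drop_nth 0) // nth_index //.
  by rewrite perm_catC /= perm_cons perm_catC.
- exact: ba.
- move=> l lin la; apply: foldr_max_ge; rewrite -E mem_filter la; exact: lin.
- by rewrite set_nthE ib perm_catC /= perm_cons perm_catC.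
Qed.

(* An exchange argument: Best Fit loses at most one pair of the given matching
   each time it packs a large and a non-large item together. *)
Lemma bf_matching_bound loads r g :
  all [pred l | 1 / 3 < l] loads -> all [pred a | 1 / 3 < a] r ->
  (count (predC large) loads <= 1)%N ->
  lm_matching (filter large loads) r g ->
  (size (foldl (@bf_step R) loads r)
     + (count (predC large) loads + count (predC large) r + g)./2
   <= size loads + size r)%N.
Proof.
elim: r loads g => [|a r IH] loads g /= hl hr e1.
  by move=> ->; lia.
case/andP: hr => ha hr w.
case: bf_stepP => [nofit|x T loads' pl xa xmax pl'].
  have [aL|aM] := boolP (large a).
    rewrite aL in w; have := IH (rcons loads a) g.
    rewrite all_rcons /= ha hl hr -cats1 count_cat filter_cat size_cat /= aL /=.
    rewrite !addn0 => /(_ isT isT e1); rewrite cats1 => IHa.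
    have {}w : lm_matching (rcons (filter large loads) a) r g.
      by apply: lm_matching_perm w; rewrite perm_sym perm_rcons.
    by move: (IHa w); lia.
  (* A small load would have had room for the small item [a]. *)
  have e0 : count (predC large) loads = 0%N.
    apply/eqP; rewrite -leqn0 leqNgt -has_count; apply/hasPn => l lin /=.
    rewrite negbK; have := nofit _ lin; move: aM; rewrite /large; lra.
  rewrite (negbTE aM) in w.
  have := IH (rcons loads a) g.
  rewrite all_rcons /= ha hl hr -cats1 count_cat filter_cat size_cat /= (negbTE aM) /=.
  rewrite e0 cats0 !addn0 => /(_ isT isT isT) IHa.
  case: w => [/IHa|[l [S' [g' [pS la _ _]]]]]; first by lia.
  have : l \in filter large loads by rewrite (perm_mem pS) mem_head.
  by rewrite mem_filter => /andP[_ /nofit]; lra.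
have hx : 1 / 3 < x /\ all [pred l | 1 / 3 < l] T.
  by move: hl; rewrite (perm_all _ pl) /= => /andP.
have xaL : large (x + a).
  by case: hx => hx _; move: ha => /=; rewrite /large; lra.
have pF : perm_eq (filter large loads) (filter large (x :: T)) by apply: perm_filter.
have pF' : perm_eq (filter large loads') (x + a :: filter large T).
  by rewrite (perm_trans (perm_filter _ pl')) //= xaL.
have hl' : all [pred l | 1 / 3 < l] loads'.
  rewrite (perm_all _ pl') /= hx.2 andbT; case: hx => hx _; move: ha => /=; lra.
(* An item is used up and no bin is opened, so the halved sum may drop by 2. The load [x + a] only
   enlarges the stock, hence a matching from [T] suffices. *)
have {}IH g' : (count (predC large) T <= 1)%N ->
    lm_matching (filter large T) r g' ->
   (size (foldl (@bf_step R) loads' r)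
     + (count (predC large) T + count (predC large) r + g')./2
   <= size loads + size r)%N.
  move=> eT wT; have := IH loads' g' hl' hr.
  rewrite (seq.permP pl') /= xaL /= (perm_size pl) (perm_size pl') /=.
  apply=> //; apply: (lm_matching_perm (S := x + a :: filter large T)).
    by rewrite perm_sym.
  exact: lm_matching_cons.
move: e1; rewrite (seq.permP pl) /= => e1.
have {}w := lm_matching_perm (r := a :: r) pF w.
have [xL|xM] := boolP (large x).
  have aM : ~~ large a by move: xL; rewrite /large; lra.
  move: w; rewrite /= xL (negbTE aM) /= in e1 * => w.
  (* The small count loses [a], so one pair may be lost. If the matching skips [a], the lost pair is
     that of [x]. If it gives [l] to [a], that pair is lost and [l] replaces [x] later on; [l <= x]
     because Best Fit chose [x]. *)
  have {}w : lm_matching (filter large T) r g.-1.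
    case: w => [|[l [S' [g' [pS la -> w]]]]]; first exact: lm_matching_behead.
    case: (perm_cons_split pS) => [[_ pSS]|[U [pSU pSx]]] /=.
      by apply: lm_matching_perm w; rewrite perm_sym.
    apply: (@lm_matching_perm (l :: U)); first by rewrite perm_sym.
    apply: (@lm_matching_le _ x); last exact: lm_matching_perm w.
    apply: xmax => //; have : l \in filter large T by rewrite (perm_mem pSU) mem_head.
    by rewrite mem_filter (perm_mem pl) inE => /andP[_ ->]; rewrite orbT.
  by move: (IH _ e1 w); clear; lia.
move: w; rewrite /= (negbTE xM) /= in e1 * => w.
(* The small count loses [x]. If [a] is large, removing it from the stock costs at most one pair; if
   [a] is small, the count loses [a] too and no pair may be lost. *)
have eT : count (predC large) T = 0%N by move: e1; clear; lia.
rewrite eT in IH *; case: ifP w => aL.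
  by move=> /lm_matching_behead /(IH _ isT); clear; lia.
case=> [/(IH _ isT)|[l [S' [g' [pS la _ _]]]]]; first by clear; lia.
(* The matching cannot pair [a] with a large [l]: then [l] would fit, and Best Fit would not have
   preferred the small load [x]. *)
have : l \in filter large T by rewrite (perm_mem pS) mem_head.
rewrite mem_filter => /andP[lL lT].
have : l <= x by apply: xmax => //; rewrite (perm_mem pl) inE lT orbT.
by move: lL xM; rewrite /large; lra.
Qed.

End BestFit.

(** * Inversions of disjoint pairs in a random order *)

Section RandomOrder.
Variables (n : nat) (D : {set 'I_n * 'I_n}).
Hypothesis D_inj1 : {in D &, injective (fun p => p.1)}.
Hypothesis D_inj2 : {in D &, injective (fun p => p.2)}.
Hypothesis D_neq12 : {in D &, forall p q, p.1 != q.2}.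
Implicit Types (p q : 'I_n * 'I_n) (s u : 'S_n).

(** Here [u] sends an item to its arrival time; in the application [p.1] is large and [p.2] small,
    so an inverted pair has its small item first. *)
Definition inverted u p : bool := (u p.2 < u p.1)%N.

Lemma inverted_tperm u p q : p \in D -> q \in D ->
  inverted (tperm p.1 p.2 * u)%g q = (p == q) (+) inverted u q.
Proof.
move=> pD qD; rewrite /inverted !permM.
have [<-|pq] := eqVneq p q.
  rewrite tpermL tpermR ltnNge leq_eqVlt negb_or /=.
  by rewrite (inj_eq val_inj) (inj_eq perm_inj) eq_sym D_neq12.
have n1 : p.1 != q.1 by apply: contraNneq pq => e; rewrite (D_inj1 pD qD e).
have n2 : p.2 != q.2 by apply: contraNneq pq => e; rewrite (D_inj2 pD qD e).
by rewrite !tpermD // ?D_neq12 // eq_sym D_neq12.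
Qed.

Definition inversions u : nat := \sum_(p in D) inverted u p.

(** Swapping the arrival times of [p] is a bijection on permutations, and exactly one of [u] and its
    image inverts [p]. *)
Lemma sum_inverted p : p \in D ->
  (2 * \sum_(u : 'S_n) inverted u p = n`!)%N.
Proof.
move=> pD; rewrite mul2n -addnn.
rewrite {1}(reindex_inj (mulgI (tperm p.1 p.2))) -big_split /=.
rewrite (eq_bigr (fun=> 1%N)) => [|u _].
  by rewrite sum1_card card_Sn.
by rewrite inverted_tperm // eqxx /=; case: inverted.
Qed.

Lemma odd_inversions_tperm u p : p \in D ->
  odd (inversions (tperm p.1 p.2 * u)%g) = ~~ odd (inversions u).
Proof.
move=> pD; rewrite /inversions (bigD1 p) //= [in RHS](bigD1 p) //= !oddD inverted_tperm // eqxx.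
rewrite (eq_bigr (fun q => inverted u q : nat)) => [|q /andP[qD qp]].
  by rewrite !oddb; case: inverted; case: odd.
by rewrite inverted_tperm // eq_sym (negbTE qp).
Qed.

(** One swap flips the parity, so exactly half of the permutations are odd, unless [D] is empty and
    none is. *)
Lemma sum_odd_inversions : (2 * \sum_(u : 'S_n) odd (inversions u) <= n`!)%N.
Proof.
have [D0|[p pD]] := set_0Vmem D.
  by rewrite big1 ?muln0 // => u _; rewrite /inversions D0 big_set0.
rewrite mul2n -addnn {1}(reindex_inj (mulgI (tperm p.1 p.2))) -big_split /=.
rewrite (eq_bigr (fun=> 1%N)) => [|u _].
  by rewrite sum1_card card_Sn.
by rewrite odd_inversions_tperm //; case: odd.
Qed.

Lemma sum_uphalf_inversions :
  (4 * \sum_(u : 'S_n) uphalf (inversions u) <= (#|D| + 1) * n`!)%N.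
Proof.
have E : (2 * \sum_(u : 'S_n) inversions u = #|D| * n`!)%N.
  rewrite exchange_big big_distrr /= (eq_bigr (fun=> n`!)) => [|p /sum_inverted //].
  by rewrite sum_nat_const.
rewrite mulnDl mul1n -E.
apply: leq_trans (leq_add (leqnn _) sum_odd_inversions).
rewrite !big_distrr -big_split /= leq_sum // => u _.
(* Pointwise, twice [uphalf k] equals [k + odd k]. *)
by have := odd_double_half (inversions u); rewrite uphalf_half; lia.
Qed.

(** Each small item of a pair is matched to its own partner whenever the partner came first. [A]
    holds the large items seen so far and [t] the items still to come. *)
Lemma lm_matching_order (R : realType) (x : 'I_n -> R) (A t : seq 'I_n) :
  {in D, forall p, large (x p.1) && ~~ large (x p.2)} ->
  {in D, forall p, x p.1 + x p.2 <= 1} -> uniq t ->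
  lm_matching (map x A) (map x t)
    #|[set p in D | (p.2 \in t) &&
                    ((p.1 \in A) || (index p.1 t < index p.2 t)%N)]|.
Proof.
move=> DL D1; elim: t A => [|j t IH] A /=.
  by move=> _; apply: eq_card0 => p; rewrite !inE /= andbF.
case/andP=> jt ut; have [jL|jM] := boolP (large (x j)).
  have -> : [set p in D | (p.2 \in j :: t) && ((p.1 \in A) ||
               ((if j == p.1 then 0 else (index p.1 t).+1)
                < (if j == p.2 then 0 else (index p.2 t).+1))%N)]
          = [set p in D | (p.2 \in t) && ((p.1 \in j :: A) ||
               (index p.1 t < index p.2 t)%N)].
    apply/setP => p; rewrite !inE; case pD: (p \in D) => //=.
    have /andP[_ pM] := DL _ pD.
    have /negbTE jp : j != p.2 by apply: contraTneq jL => ->.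
    by rewrite eq_sym jp (eq_sym p.1); case: (j == p.1); rewrite ?orbT.
  exact: (IH (j :: A)).
have [/existsP[p0 /and3P[p0D /eqP p02 p01]]|nop] :=
    boolP [exists p, [&& p \in D, p.2 == j & p.1 \in A]].
  right; exists (x p0.1), (map x (rem p0.1 A)).
  exists #|[set p in D | (p.2 \in t) && ((p.1 \in rem p0.1 A) ||
               (index p.1 t < index p.2 t)%N)]|; split.
  - by rewrite -map_cons perm_map // perm_to_rem.
  - by rewrite -p02; apply: D1.
  (* The pairs are disjoint, so using up [p0.1] affects the pair [p0] only. *)
  - rewrite [LHS](cardsD1 p0) !inE p0D p02 eqxx p01 /= add1n; congr _.+1.
    apply: eq_card => p; rewrite !inE.
    have [->|pp0] /= := eqVneq p p0; first by rewrite p02 (negbTE jt) andbF.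
    case pD: (p \in D) => //=.
    have /negbTE n2 : j != p.2.
      by apply: contraNneq pp0 => e; apply/eqP/D_inj2; rewrite // p02.
    have n1 : p.1 != p0.1 by apply: contraNneq pp0 => e; apply/eqP/D_inj1.
    have -> : (j == p.1) = false by rewrite -p02 eq_sym (negbTE (D_neq12 pD p0D)).
    rewrite eq_sym n2 /= ltnS; congr (_ && (_ || _)).
    apply/idP/idP => [pA|/mem_rem //].
    by move: pA; rewrite (perm_mem (perm_to_rem p01)) inE (negbTE n1).
  - exact: IH.
(* A pair with small item [j] is not counted: its partner is not in [A], and nothing precedes the
   head [j]. *)
left; rewrite (_ : [set p in D | _] = [set p in D | (p.2 \in t) && ((p.1 \in A) ||
               (index p.1 t < index p.2 t)%N)]); first exact: IH.
apply/setP => p; rewrite !inE; case pD: (p \in D) => //=.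
have /andP[pL _] := DL _ pD.
have /negbTE -> : j != p.1 by apply: contraNneq jM => ->.
have [e|_] := eqVneq j p.2; last by rewrite ltnS.
rewrite -e (negbTE jt) ltn0 !orbF /=.
apply: contraNF nop => pA; apply/existsP; exists p.
by rewrite pD -e eqxx.
Qed.

End RandomOrder.

(** * Bins of a feasible packing and their mixed pairs *)

Section Packing.
Variables (R : realType) (n m : nat) (x : 'I_n -> R) (f : 'I_n -> 'I_m).
Hypothesis x_gt : forall i, 1 / 3 < x i.
Hypothesis f_packing : forall b, \sum_(i < n | f i == b) x i <= 1.

Lemma card_bin_lt (c : R) (A : {set 'I_n}) b : 0 < c ->
  {in A, forall i, (f i == b) && (c < x i)} -> #|A|%:R * c < 1.
Proof.
move=> c0 Ab; have [->|[i0 i0A]] := set_0Vmem A.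
  by rewrite cards0 mul0r.
apply: (@lt_le_trans _ _ (\sum_(i in A) x i)).
  rewrite mulr_natl -sumr_const; apply: ltr_sum => [|i /Ab /andP[] //].
  by apply/hasP; exists i0; rewrite ?mem_index_enum.
apply: le_trans (f_packing b).
rewrite [leRHS](bigID (mem A)) /= [X in _ <= X + _](eq_bigl (fun i => i \in A)) => [|i].
  rewrite lerDl sumr_ge0 // => i _; have := x_gt i; lra.
by rewrite andbC /=; case iA: (i \in A) => //; case/andP: (Ab i iA).
Qed.

Definition bin_large b : {set 'I_n} := [set i | (f i == b) && large (x i)].
Definition bin_small b : {set 'I_n} := [set i | (f i == b) && ~~ large (x i)].

Lemma card_bin_large b : (#|bin_large b| <= 1)%N.
Proof.
have := @card_bin_lt (1 / 2) (bin_large b) b; rewrite leqNgt => H.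
apply/negP; rewrite -(ler_nat R).
have : #|bin_large b|%:R * (1 / 2) < 1 :> R; last by lra.
by apply: H; [lra | move=> i; rewrite inE].
Qed.

Lemma card_bin b : (#|bin_large b| + #|bin_small b| <= 2)%N.
Proof.
have -> : (#|bin_large b| + #|bin_small b|)%N = #|[set i | f i == b]|.
  rewrite -(cardsID [set i | large (x i)]).
  by congr (_ + _)%N; apply: eq_card => i; rewrite !inE // andbC.
have := @card_bin_lt (1 / 3) [set i | f i == b] b; rewrite leqNgt => H.
apply/negP; rewrite -(ler_nat R).
have : #|[set i | f i == b]|%:R * (1 / 3) < 1 :> R; last by lra.
by apply: H; [lra | move=> i; rewrite inE x_gt => ->].
Qed.

Definition mixed_pairs : {set 'I_n * 'I_n} :=
  [set p | [&& f p.1 == f p.2, large (x p.1) & ~~ large (x p.2)]].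

Lemma mixed_pairs_bins p : p \in mixed_pairs ->
  p.1 \in bin_large (f p.1) /\ p.2 \in bin_small (f p.1).
Proof. by rewrite !inE eq_sym eqxx => /and3P[-> -> ->]. Qed.

Lemma mixed_pairs_inj1 : {in mixed_pairs &, injective (fun p => p.1)}.
Proof.
move=> [i j] [i' k] /mixed_pairs_bins[/= iL jM] /mixed_pairs_bins[/= _ kM] /= e.
rewrite -{i'}e in kM *; congr pair.
have : (#|bin_small (f i)| <= 1)%N.
  have := card_bin (f i); have : (0 < #|bin_large (f i)|)%N by apply/card_gt0P; exists i.
  by lia.
by move/card_le1_eqP; apply.
Qed.

Lemma mixed_pairs_inj2 : {in mixed_pairs &, injective (fun p => p.2)}.
Proof.
move=> [i k] [j k'] ip jp /= e; rewrite -{k'}e in jp *; congr pair.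
have /card_le1_eqP := card_bin_large (f k); apply; rewrite inE.
  by move: jp; rewrite inE /= => /and3P[-> ->].
by move: ip; rewrite inE /= => /and3P[-> ->].
Qed.

Lemma mixed_pairs_neq12 : {in mixed_pairs &, forall p q, p.1 != q.2}.
Proof.
move=> p q; rewrite !inE => /and3P[_ pL _] /and3P[_ _ qM].
by apply: contraNneq qM => <-.
Qed.

Lemma mixed_pairs_le1 : {in mixed_pairs, forall p, x p.1 + x p.2 <= 1}.
Proof.
move=> p pD; apply: le_trans (f_packing (f p.1)).
have /mixed_pairs_bins[] := pD; rewrite !inE => /andP[f1 _] /andP[f2 _].
rewrite (bigD1 p.1) // (bigD1 p.2) /=; last first.
  by rewrite f2 eq_sym mixed_pairs_neq12.
by rewrite addrA lerDl sumr_ge0 // => i _; have := x_gt i; lra.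
Qed.

(** Summed over bins: with L large and S small items in a bin, 2(L + S) <= 2 + S + LS, since L <= 1
    and L + S <= 2. The product LS counts the mixed pairs of the bin. *)
Lemma card_mixed_pairs :
  (2 * n <= 2 * m + #|[set i | ~~ large (x i)]| + #|mixed_pairs|)%N.
Proof.
have cardE (A : {set 'I_n}) : #|A| = (\sum_b #|[set i in A | f i == b]|)%N.
  rewrite -sum1_card (partition_big f predT) //=.
  by apply: eq_bigr => b _; rewrite -sum1_card; apply: eq_bigl => i; rewrite inE.
have pairsE : #|mixed_pairs| = (\sum_b #|bin_large b| * #|bin_small b|)%N.
  rewrite -sum1_card (partition_big (fun p => f p.1) predT) //=.
  apply: eq_bigr => b _; rewrite -cardsX -sum1_card; apply: eq_bigl => p.
  rewrite !inE; have [<-|] := eqVneq (f p.1) b; last by rewrite !andbF.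
  by rewrite eq_sym andbT; case: large; case: large; rewrite ?andbF ?andbT.
have nE : n = (\sum_b (#|bin_large b| + #|bin_small b|))%N.
  rewrite -[LHS]card_ord -cardsT -(cardsID [set i | large (x i)]) !cardE -big_split.
  apply: eq_bigr => b _; congr (_ + _)%N; apply: eq_card => i;
    by rewrite !inE andbC // andbT.
have -> : (2 * m = \sum_(b < m) 2)%N by rewrite sum_nat_const card_ord mulnC.
rewrite [X in (2 * X <= _)%N]nE cardE pairsE big_distrr -!big_split leq_sum //= => b _.
have -> : [set i in [set i | ~~ large (x i)] | f i == b] = bin_small b.
  by apply/setP => i; rewrite !inE andbC.
have := card_bin_large b; have := card_bin b.
by case: #|bin_large b| => [|[|//]]; move: #|bin_small b|; clear; lia.
Qed.

Lemma card_mixed_pairs_le : (#|mixed_pairs| <= m)%N.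
Proof.
have inj : {in mixed_pairs &, injective (fun p => f p.1)}.
  move=> p q pD qD /= e; apply: mixed_pairs_inj1 => //.
  have /card_le1_eqP := card_bin_large (f p.1); apply; last exact: (mixed_pairs_bins pD).1.
  by rewrite e; exact: (mixed_pairs_bins qD).1.
by rewrite -(card_in_imset inj) -[leqRHS]card_ord max_card.
Qed.

Lemma BF_permuted_le (s : 'S_n) :
  (BF (permuted_list x s) <= m + uphalf (inversions mixed_pairs s^-1%g))%N.
Proof.
set t := [seq s i | i <- enum 'I_n].
have tE : permuted_list x s = map x t by rewrite /t -map_comp.
have ut : uniq t by rewrite map_inj_uniq ?enum_uniq //; apply: perm_inj.
have mt i : i \in t.
  by rewrite -[i](permKV s) mem_map ?mem_enum //; apply: perm_inj.
(* Arrival times are given by the inverse of [s], hence the inversions of [s^-1]. *)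
have it i : index i t = s^-1%g i.
  by rewrite -{1}[i](permKV s) index_map ?index_enum_ord //; apply: perm_inj.
have DL : {in mixed_pairs, forall p, large (x p.1) && ~~ large (x p.2)}.
  by move=> p; rewrite inE => /and3P[_ -> ->].
have := lm_matching_order mixed_pairs_inj1 mixed_pairs_inj2 mixed_pairs_neq12
  [::] DL mixed_pairs_le1 ut.
set g := #|_| => /(bf_matching_bound (loads := [::]) isT) H.
have rE : all [pred a | 1 / 3 < a] (map x t).
  by rewrite all_map; apply/allP => i _ /=; apply: x_gt.
have {H} := H rE isT; rewrite -tE -/(BF _).
have -> : count (predC (@large R)) (permuted_list x s) = #|[set i | ~~ large (x i)]|.
  rewrite tE count_map -size_filter -(card_uniqP _) ?filter_uniq //.
  by apply: eq_card => i; rewrite !inE mem_filter /= mt andbT.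
have -> : size (permuted_list x s) = n by rewrite size_map size_enum_ord.
rewrite /= !add0n.
(* Here [g] counts the pairs whose large item comes first; the remaining ones are inverted. *)
have DE : #|mixed_pairs| = (g + inversions mixed_pairs s^-1%g)%N.
  rewrite /g -!sum1_card /inversions.
  rewrite [LHS]big_mkcond [X in (X + _)%N]big_mkcond [X in (_ + X)%N]big_mkcond.
  rewrite -big_split /=; apply: eq_bigr => p _.
  case pD: (p \in mixed_pairs); rewrite inE pD //= mt !it /inverted.
  have := mixed_pairs_neq12 pD pD.
  by rewrite -(inj_eq (@perm_inj _ s^-1%g)) -(inj_eq val_inj) /=; case: ltngtP.
have := card_mixed_pairs; rewrite DE.
by move: {DE}g (BF _) (inversions _ _) #|_|; clear; lia.
Qed.

End Packing.

(** * Attainment of the optimum and the expectation *)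

Lemma OPT_packable (R : realType) (n : nat) (x : 'I_n -> R) :
  (forall i, x i <= 1) -> packable (OPT x) x.
Proof.
move=> x1; apply: (big_ind (fun m => packable m x)) => //.
(* The default value [n] of the minimum is feasible: one item per bin. *)
- apply/existsP; exists [ffun i => i]; apply/forallP => b.
  by rewrite (eq_bigl (pred1 b)) ?big_pred1_eq // => i; rewrite ffunE.
- by move=> a b pa pb; rewrite /minn; case: ifP.
Qed.

Theorem theorem1 (R : realType) (n : nat) (x : 'I_n -> R)
  (hx : forall i : 'I_n, 1 / 3 < x i <= 1) :
  expected_BF x <= 5 / 4 * (OPT x)%:R + 1 / 4.
Proof.
have x_gt i : 1 / 3 < x i by case/andP: (hx i).
have x_le i : x i <= 1 by case/andP: (hx i).
have /existsP[f /forallP f1] := OPT_packable x_le.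
set m := OPT x in f f1 *.
set D := mixed_pairs x f.
have BFD := BF_permuted_le x_gt f1.
have Dm : (#|D| <= m)%N := card_mixed_pairs_le x_gt f1.
have nE : #|{perm 'I_n}| = n`! by rewrite card_Sn.
rewrite /expected_BF nE ler_pdivrMr ?ltr0n ?fact_gt0 // -natr_sum.
have : (4 * \sum_(s : 'S_n) BF (permuted_list x s) <= (5 * m + 1) * n`!)%N.
  apply: leq_trans (_ : 4 * \sum_(u : 'S_n) (m + uphalf (inversions D u)) <= _)%N.
    (* Inversion permutes the symmetric group, so averaging over [s^-1] is averaging over [s]. *)
    rewrite leq_mul2l /= [leqRHS](reindex_inj invg_inj) /=.
    by apply: leq_sum => s _; apply: BFD.
  rewrite big_split /= sum_nat_const nE mulnDr.
  have := sum_uphalf_inversions (mixed_pairs_inj1 x_gt f1)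
    (mixed_pairs_inj2 x_gt f1) (@mixed_pairs_neq12 _ _ _ x f).
  (* The term [4 * m] comes from the packing and the further [m + 1] from [#|D| + 1] with
     [#|D| <= m]. *)
  rewrite -/D; move: (\sum_u uphalf _)%N n`! #|D| Dm; clear; nia.
rewrite -(ler_nat R) !natrM natrD natrM; lra.
Qed.
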